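(* Let $\mathfrak{c}=2^{\aleph_0}$. The free group with $\mathfrak{c}$-many generators admits a selectively sequentially pseudocompact zero-dimensional group topology, and the free Abelian group with $\mathfrak{c}$-many generators admits a selectively sequentially pseudocompact zero-dimensional group topology.
   Context: All group topologies are assumed to be Hausdorff. A group topology is a topology making the group operations continuous. A topological space is zero-dimensional if it has a base consisting of clopen sets. A topological space $X$ is called selectively sequentially pseudocompact if for every sequence $\{U_n:n\in\mathbb{N}\}$ of non-empty open subsets of $X$ one can choose a point $x_n\in U_n$ for every $n\in\mathbb{N}$ in such a way that the sequence $\{x_n:n\in\mathbb{N}\}$ has a subsequence converging to some point of $X$. *)

(* Defs.v *)
From HB Require Import structures.
From mathcomp Require Import all_boot all_order all_algebra.
From mathcomp Require Import all_classical all_reals all_analysis.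
From mathcomp Require Import freeg.

Set Implicit Arguments.
Unset Strict Implicit.
Unset Printing Implicit Defensive.

Local Open Scope classical_set_scope.
Local Open Scope card_scope.
Local Open Scope group_scope.

(* A letter (x, true) stands for the generator x, and (x, false) for its
   formal inverse.  Elements of the free group are the reduced words. *)
Section FreeGroup.
Variable X : choiceType.
Implicit Types (a b : X * bool) (s t w : seq (X * bool)).

Definition letter_inv a : X * bool := (a.1, ~~ a.2).

Definition reduced_word w : bool := sorted (fun a b => b != letter_inv a) w.

Record free_group := FreeWord {
  word_of :> seq (X * bool);
  _ : reduced_word word_of
}.

HB.instance Definition _ := [isSub for word_of].
HB.instance Definition _ := [Choice of free_group by <:].

Definition push_letter a w :=
  if w is b :: w' then if b == letter_inv a then w' else a :: w else [:: a].

Definition reduce_word w := foldr push_letter [::] w.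

Lemma letter_invK : involutive letter_inv.
Proof. by case=> x b; rewrite /letter_inv /= negbK. Qed.

Lemma reduced_behead a w : reduced_word (a :: w) -> reduced_word w.
Proof. by case: w => //= b w /andP[]. Qed.

Lemma push_reduced a w : reduced_word w -> reduced_word (push_letter a w).
Proof.
case: w => //= b w rw; case: ifPn => [_|nba] /=; first exact: (@reduced_behead b).
by rewrite nba.
Qed.

Lemma foldr_push_reduced s w :
  reduced_word w -> reduced_word (foldr push_letter w s).
Proof. by move=> rw; elim: s => //= a s; exact: push_reduced. Qed.

Lemma reduce_word_reduced w : reduced_word (reduce_word w).
Proof. exact: foldr_push_reduced. Qed.

Lemma push_letterK a w :
  reduced_word w -> push_letter a (push_letter (letter_inv a) w) = w.
Proof.
case: w => [|b w] /=; first by rewrite eqxx.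
rewrite letter_invK; have [-> rw|_ rw] := eqVneq b a; last by rewrite /= eqxx.
by case: w rw => //= c w /andP[/negbTE->].
Qed.

Lemma reduce_word_id w : reduced_word w -> reduce_word w = w.
Proof.
elim: w => //= a w IHw rw.
rewrite -/(reduce_word w) IHw ?(reduced_behead rw) //.
by case: w rw {IHw} => //= b w /andP[/negbTE->].
Qed.

Lemma foldr_push_reduce s w : reduced_word w ->
  foldr push_letter w (reduce_word s) = foldr push_letter w s.
Proof.
move=> rw; elim: s => //= a s <-; rewrite -/(reduce_word s).
case: (reduce_word s) => //= b t; case: eqP => //= ->.
by rewrite push_letterK // foldr_push_reduced.
Qed.

Lemma reduce_word_cat s t :
  reduce_word (s ++ t) = foldr push_letter (reduce_word t) s.
Proof. exact: foldr_cat. Qed.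

Definition word_inv w := map letter_inv (rev w).

Lemma word_invK : involutive word_inv.
Proof.
by move=> w; rewrite /word_inv -map_rev revK -map_comp map_id_in // => a _;
  exact: letter_invK.
Qed.

Lemma word_inv_reduced w : reduced_word w -> reduced_word (word_inv w).
Proof.
rewrite /reduced_word /word_inv sorted_map rev_sorted.
apply: sub_sorted => a b /=; apply: contraNN => /eqP.
by move/(can_inj letter_invK) ->; rewrite letter_invK.
Qed.

Lemma foldr_push_inv s w : reduced_word w ->
  foldr push_letter (foldr push_letter w s) (word_inv s) = w.
Proof.
move=> rw; elim: s => //= a s IHs.
rewrite /word_inv rev_cons map_rcons foldr_rcons.
by rewrite -[X in push_letter _ (push_letter X _)]letter_invK push_letterK
  ?foldr_push_reduced.
Qed.

Definition free_one : free_group := @FreeWord [::] isT.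
Definition free_mul (u v : free_group) : free_group :=
  FreeWord (reduce_word_reduced (u ++ v)).
Definition free_inv (u : free_group) : free_group :=
  FreeWord (word_inv_reduced (valP u)).

Fact free_mulA : associative free_mul.
Proof.
move=> u v w; apply: val_inj => /=.
rewrite [RHS]reduce_word_cat foldr_push_reduce ?reduce_word_reduced //.
by rewrite -reduce_word_cat -catA [RHS]reduce_word_cat [LHS]reduce_word_cat
  [in LHS]reduce_word_id ?reduce_word_reduced.
Qed.

Fact free_mul1 : left_id free_one free_mul.
Proof. by move=> u; apply: val_inj; rewrite /= reduce_word_id ?(valP u). Qed.

Fact free_mulr1 : right_id free_one free_mul.
Proof.
by move=> u; apply: val_inj; rewrite /= cats0 reduce_word_id ?(valP u).
Qed.

Fact free_mulV : left_inverse free_one free_inv free_mul.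
Proof.
move=> u; apply: val_inj; rewrite /= reduce_word_cat.
exact: foldr_push_inv.
Qed.

Fact free_mulrV : right_inverse free_one free_inv free_mul.
Proof.
move=> u; apply: val_inj; rewrite /= reduce_word_cat.
rewrite -[X in foldr _ _ X]word_invK; exact: foldr_push_inv.
Qed.

HB.instance Definition _ := isGroup.Build free_group
  free_mulA free_mul1 free_mulr1 free_mulV free_mulrV.

Definition free_gen (x : X) : free_group := @FreeWord [:: (x, true)] isT.

(* free_lift_gen, free_liftM and free_lift_unique together say that free_group
   has the universal property of the free group on X. *)
Section Lift.
Variables (H : groupType) (f : X -> H).

Definition letter_val a : H := if a.2 then f a.1 else (f a.1)^-1.

Definition free_lift (u : free_group) : H := \prod_(a <- u) letter_val a.

Lemma letter_val_inv a : letter_val (letter_inv a) = (letter_val a)^-1.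
Proof. by case: a => x [] //=; rewrite /letter_val /= invgK. Qed.

Lemma prod_reduce_word w :
  \prod_(a <- reduce_word w) letter_val a = \prod_(a <- w) letter_val a.
Proof.
elim: w => //= a w IHw; rewrite -/(reduce_word w) [RHS]big_cons -IHw.
case: (reduce_word w) => [|b t] /=; first by rewrite big_cons.
case: eqP => [->|_]; last by rewrite big_cons.
by rewrite big_cons letter_val_inv mulgA mulgV mul1g.
Qed.

Lemma free_lift_gen x : free_lift (free_gen x) = f x.
Proof. by rewrite /free_lift big_seq1. Qed.

Lemma free_liftM : {morph free_lift : u v / u * v}.
Proof. by move=> u v; rewrite /free_lift prod_reduce_word big_cat. Qed.

Lemma free_lift_unique (phi : free_group -> H) :
  {morph phi : u v / u * v} -> (forall x, phi (free_gen x) = f x) ->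
  phi =1 free_lift.
Proof.
move=> phiM phif.
have phi1 : phi 1 = 1 by apply: (@mulgI _ (phi 1)); rewrite -phiM !mulg1.
have phiV u : phi u^-1 = (phi u)^-1.
  by apply: (@mulgI _ (phi u)); rewrite -phiM !mulgV.
case=> w; elim: w => [|a w IHw] rw.
  by rewrite /free_lift big_nil -phi1; congr phi; exact: val_inj.
have la : reduced_word [:: a] by [].
have rwE : FreeWord rw = FreeWord la * FreeWord (reduced_behead rw).
  by apply: val_inj; rewrite -[LHS](reduce_word_id rw).
rewrite [in LHS]rwE phiM IHw /free_lift /= big_cons; congr (_ * _).
case: a la {rw rwE} => x [] la; rewrite /letter_val /= -phif.
  by congr phi; apply: val_inj.
by rewrite -phiV; congr phi; apply: val_inj.
Qed.

End Lift.
End FreeGroup.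

Definition has_cardinality_continuum (X : Type) : Prop :=
  [set: X] #= [set: nat -> bool].

(* The library's zero_dimensional only asks that clopen sets separate points,
   which is weaker than having a base of clopen sets. *)
Definition zero_dimensional_space (T : topologicalType) : Prop :=
  exists2 B : set (set T), basis B & forall U, B U -> clopen U.

Definition selectively_sequentially_pseudocompact (T : topologicalType) : Prop :=
  forall U : nat -> set T, (forall n, open (U n) /\ U n !=set0) ->
  exists x : nat -> T, (forall n, U n (x n)) /\
    exists k : nat -> nat, increasing_seq k /\
      exists l : T, (x \o k) @ \oo --> l.

(* A topology on the carrier of G, given by its family of open sets. *)
Definition topology_on (G : choiceType) : Type :=
  isOpenTopological.axioms_ G (Choice.class G) (Choice.class G).

Definition topologize (G : choiceType) (tau : topology_on G) :
    topologicalType :=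
  let m : isOpenTopological.axioms_ G (Choice.class G) (Choice.class G) := tau
  in HB.pack G m.

Definition group_topology (G : groupType) (tau : topology_on G) : Prop :=
  let T := topologize tau in
  [/\ hausdorff_space T,
      continuous (fun p : T * T => ((p.1 : G) * (p.2 : G) : G) : T) &
      continuous (fun x : T => ((x : G)^-1 : G) : T)].

Definition admits_group_topology (P : topologicalType -> Prop)
    (G : groupType) : Prop :=
  exists2 tau : topology_on G, group_topology tau & P (topologize tau).

(* Main.v *)
(* G is embedded in a product of c many finite groups K_i, with the topology it
   inherits, so that only the selection property and injectivity need care.
   The free generators are labelled x_{s,n} and x_{s,oo}, where s ranges over the
   c many sequences of points of countable subproducts. The coordinates of
   x_{s,n} in the countable support of s are those prescribed by the n-th term of
   s, and those of x_{s,oo} are the limits, when they exist. Given open sets U_n,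
   finitely many coordinates decide membership in each U_n, and a diagonal
   argument gives a convergent subsequence of points of the countable subproduct
   involved; the corresponding generators then lie in the U_n and converge.
   The coordinates outside the supports remain free: since each g <> 1 has
   uncountably many coordinates reserved for it, one of them lies outside the
   supports of the generators in g, and there residual finiteness is used to
   separate g from 1. *)
Require Import Defs.
From HB Require Import structures.
From mathcomp Require Import all_boot all_order all_algebra all_fingroup.
From mathcomp Require Import all_classical all_reals all_analysis.
From mathcomp Require Import freeg.

Set Implicit Arguments.
Unset Strict Implicit.
Unset Printing Implicit Defensive.

Local Open Scope classical_set_scope.
Local Open Scope card_scope.
Local Open Scope group_scope.

Lemma group_morph1 (G H : groupType) (f : G -> H) :
  {morph f : u v / u * v} -> f 1 = 1.
Proof. by move=> fM; apply: (@mulgI _ (f 1)); rewrite -fM !mulg1. Qed.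

Lemma group_morphV (G H : groupType) (f : G -> H) :
  {morph f : u v / u * v} -> {morph f : u / u^-1}.
Proof.
by move=> fM u; apply: (@mulgI _ (f u)); rewrite -fM !mulgV (group_morph1 fM).
Qed.

(** * Group topologies induced by homomorphisms into discrete groups *)

Section InitialTopology.
Variables (G : groupType) (I : choiceType) (K : I -> groupType).
Variable phi : forall i, G -> K i.

(** Each [K i] is discrete, so fixing finitely many coordinates gives a basic open set. *)
Definition cylinder (F : seq I) (g : G) : set G :=
  [set h | forall i, i \in F -> phi i h = phi i g].

Definition initial_open : set (set G) :=
  [set U | forall g, U g -> exists F, cylinder F g `<=` U].

Fact initial_openT : initial_open setT.
Proof. by move=> g _; exists [::]. Qed.

Fact initial_openI : setI_closed initial_open.
Proof.
move=> U V oU oV g [/oU[E EU] /oV[F FV]]; exists (E ++ F) => h hEF.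
by split; [apply: EU | apply: FV] => i iE; apply: hEF; rewrite mem_cat iE ?orbT.
Qed.

Fact initial_open_bigU (J : Type) (f : J -> set G) :
  (forall j, initial_open (f j)) -> initial_open (\bigcup_j f j).
Proof.
by move=> of_ g [j _ /of_[F Ff]]; exists F => h /Ff fh; exists j.
Qed.

Definition initial_topology : topology_on G :=
  isOpenTopological.Build G initial_openT initial_openI initial_open_bigU.

Local Notation T := (topologize initial_topology).

Lemma initial_openE (U : set T) : open U <-> initial_open U.
Proof. by []. Qed.

Lemma cylinder_refl F g : cylinder F g g. Proof. by []. Qed.

Lemma cylinder_open F g : open (cylinder F g : set T).
Proof. by apply/initial_openE => h hF; exists F => u uF i iF; rewrite uF ?hF. Qed.

Lemma nbhs_cylinder F (g : T) : nbhs g (cylinder F g).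
Proof.
apply: (@open_nbhs_nbhs T); split; first exact: cylinder_open.
exact: cylinder_refl.
Qed.

Lemma nbhs_initialP (g : T) (A : set T) :
  nbhs g A <-> exists F, cylinder F g `<=` A.
Proof.
split=> [|[F FA]]; last exact: filterS FA (nbhs_cylinder F g).
rewrite nbhsE => -[U [/initial_openE oU Ug] UA].
by have [F FU] := oU _ Ug; exists F; apply: subset_trans UA.
Qed.

Lemma cylinder_clopen F g : clopen (cylinder F g : set T).
Proof.
split; first exact: cylinder_open.
rewrite -openC; apply/initial_openE => h nFh; exists F => u uF Fu; apply: nFh.
by move=> i iF; rewrite -uF ?Fu.
Qed.

Lemma initial_zero_dimensional : zero_dimensional_space T.
Proof.
exists [set U | exists F g, U = cylinder F g]; last first.
  by move=> _ [F [g ->]]; apply: cylinder_clopen.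
split=> [_ [F [g ->]]|g A]; first exact: cylinder_open.
move=> /nbhs_initialP[F FA]; exists (cylinder F g) => //.
by split; [exists F, g | exact: cylinder_refl].
Qed.

Hypothesis phiM : forall i, {morph phi i : g h / g * h}.
Hypothesis phi_sep : forall g, g != 1 -> exists i, phi i g != 1.

Lemma initial_group_topology : group_topology initial_topology.
Proof.
split=> /=.
- rewrite open_hausdorff => g h gh.
  (* A coordinate that does not kill [g * h^-1] yields disjoint cylinders around [g] and [h]. *)
  have [|i] := @phi_sep (g * h^-1).
    apply: contraNneq gh => /(congr1 (fun x => x * h)).
    by rewrite mulgVK mul1g => /eqP.
  rewrite phiM (group_morphV (@phiM _)) => phi_gh.
  exists (cylinder [:: i] g, cylinder [:: i] h) => /=.
    by split; rewrite inE; exact: cylinder_refl.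
  split; [exact: cylinder_open..|apply/eqP].
  rewrite -subset0 => u [/(_ i) ug /(_ i) uh]; move: phi_gh.
  by rewrite -ug ?mem_head // uh ?mem_head // mulgV eqxx.
- move=> [g h] A /nbhs_initialP[F FA].
  exists (cylinder F g, cylinder F h) => /=.
    by split; exact: nbhs_cylinder.
  move=> [g' h'] [/= Fg Fh]; apply: FA => i iF.
  by rewrite !phiM Fg ?Fh.
- move=> g A /nbhs_initialP[F FA]; apply/nbhs_initialP; exists F => h Fh.
  by apply: FA => i iF; rewrite !(group_morphV (@phiM _)) Fh.
Qed.

Lemma cvg_initial (x : nat -> T) (l : T) :
  (forall i, exists N, forall n, (N <= n)%N -> phi i (x n) = phi i l) ->
  x @ \oo --> l.
Proof.
move=> xl A /nbhs_initialP[F FA].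
suff [N NF] : exists N, forall n, (N <= n)%N -> cylinder F l (x n).
  by exists N => // n /NF /FA.
elim: F {FA} => [|i F [N NF]]; first by exists 0%N.
have [M Mi] := xl i; exists (maxn M N) => n; rewrite geq_max => /andP[Mn Nn] j.
by rewrite inE => /predU1P[->|jF]; [exact: Mi | exact: NF].
Qed.

End InitialTopology.

(** * Sets of cardinality at most the continuum *)

Definition continuum_embeddable (A : Type) : Prop :=
  exists f : A -> nat -> bool, injective f.

Lemma embeddable_inj A B (f : A -> B) :
  injective f -> continuum_embeddable B -> continuum_embeddable A.
Proof. by move=> f_inj [g g_inj]; exists (g \o f); apply: inj_comp. Qed.

Lemma embeddable_count (A : countType) : continuum_embeddable A.
Proof.
exists (fun x n => n == pickle x) => x y /(congr1 (@^~ (pickle x))).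
by rewrite eqxx => /esym/eqP/(pcan_inj pickleK).
Qed.

Lemma embeddable_prod A B :
  continuum_embeddable A -> continuum_embeddable B ->
  continuum_embeddable (A * B).
Proof.
move=> [f f_inj] [g g_inj].
exists (fun p n => if odd n then g p.2 n./2 else f p.1 n./2).
move=> -[a b] [a' b'] /= E.
have -> : a = a'.
  apply: f_inj; apply/funext => n.
  by have := congr1 (@^~ n.*2) E; rewrite odd_double doubleK.
have -> // : b = b'.
apply: g_inj; apply/funext => n.
by have := congr1 (@^~ n.*2.+1) E; rewrite /= odd_double /= uphalf_double.
Qed.

Lemma embeddable_nat_fun A :
  continuum_embeddable A -> continuum_embeddable (nat -> A).
Proof.
move=> [f f_inj].
exists (fun u n => if unpickle n is Some p then f (u p.1) p.2 else true).
move=> u v E; apply/funext => i; apply: f_inj; apply/funext => j.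
by have := congr1 (@^~ (pickle (i, j))) E; rewrite pickleK.
Qed.

Lemma embeddable_option A :
  continuum_embeddable A -> continuum_embeddable (option A).
Proof.
move=> [f f_inj].
exists (fun o n => if o is Some a then if n is n'.+1 then f a n' else true
                   else false).
move=> [a|] [b|] // E; last 2 first.
- by have := congr1 (@^~ 0%N) E.
- by have := congr1 (@^~ 0%N) E.
congr Some; apply: f_inj; apply/funext => n.
by have := congr1 (@^~ n.+1) E.
Qed.

Lemma embeddable_seq A :
  continuum_embeddable A -> continuum_embeddable (seq A).
Proof.
move=> /embeddable_option /embeddable_nat_fun.
apply: (embeddable_inj (f := @onth A)); elim=> [|a s IHs] [|b t] // E.
  by have := congr1 (@^~ 0%N) E.
  by have := congr1 (@^~ 0%N) E.
have [->] : Some a = Some b by have := congr1 (@^~ 0%N) E.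
by congr cons; apply: IHs; apply/funext => n; have := congr1 (@^~ n.+1) E.
Qed.

Lemma continuum_bijection (X : Type) : has_cardinality_continuum X ->
  exists b : X -> nat -> bool, bijective b.
Proof.
by move=> /card_set_bijP[b]; rewrite setTT_bijective; exists b.
Qed.

(** Cantor's diagonal argument. *)
Lemma continuum_not_enumerable (X : Type) (a : nat -> X) :
  has_cardinality_continuum X -> exists x, forall n, a n <> x.
Proof.
move=> /continuum_bijection[b [b' bK b'K]].
exists (b' (fun n => ~~ b (a n) n)) => n /(congr1 b); rewrite b'K.
by move=> /(congr1 (@^~ n)); case: (b _ n).
Qed.

(** * Subsequences along which all coordinates stabilise *)

Section Subsequence.
Variables (a : nat -> nat -> nat) (B : nat -> nat).
Hypothesis aB : forall j n, (a j n < B j)%N.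

Let unbounded (P : set nat) := forall N, exists2 n, (N <= n)%N & P n.

Let pigeonhole (P : set nat) j : unbounded P ->
  exists c, unbounded (P `&` [set n | a j n = c]).
Proof.
move=> infP; apply: contrapT => /forallNP noc.
suff [N NP] : exists N, forall n, (N <= n)%N -> P n -> (B j <= a j n)%N.
  by have [n /NP le /le] := infP N; rewrite leqNgt aB.
elim: (B j) => [|b [N NP]]; first by exists 0%N.
have /existsNP[M Mb] := noc b; exists (maxn M N) => n.
rewrite geq_max => /andP[Mn Nn] Pn; rewrite ltn_neqAle NP // andbT.
by apply/eqP => ab; apply: Mb; exists n.
Qed.

(** A decreasing chain of infinite sets, with [a i] constant on [nested j] for all [i < j]. By
    [pigeonhole] the default [0] of [xget] is never taken. *)
Let nested := fix nested j : set nat := if j is j'.+1 then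
  nested j' `&` [set n | a j' n =
    xget 0%N [set c | unbounded (nested j' `&` [set n | a j' n = c])]]
  else setT.

Let nested_unbounded j : unbounded (nested j).
Proof.
elim: j => [N|j IHj]; first by exists N.
exact: (xgetPex 0%N (pigeonhole j IHj)).
Qed.

Lemma diagonal_subsequence : exists2 k, increasing_seq k &
  forall j, exists c N, forall m, (N <= m)%N -> a j (k m) = c.
Proof.
have /choice[next nextP] (p : nat * nat) :
    exists n, (p.1 < n)%N /\ nested p.2 n.
  by have [n] := nested_unbounded p.2 p.1.+1; exists n.
(* Taking [k m] in [nested m] makes [a j] constant along [k] from index [j.+1] on. *)
pose k := fix k m := if m is m'.+1 then next (k m', m'.+1) else 0%N.
have kS m : (k m < k m.+1)%N by have [] := nextP (k m, m.+1).
have k_nested m : nested m (k m).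
  by case: m => // m; have [_] := nextP (k m, m.+1).
exists k.
  by apply: leq_mono; apply: homo_ltn kS; exact: ltn_trans.
move=> j; eexists; exists j.+1 => m jm.
have nestedW : nested m `<=` nested j.+1.
  elim: m jm => // m IHm.
  by rewrite ltnS leq_eqVlt => /predU1P[->//|/IHm mj] n [/mj].
by have [_ akm] := nestedW _ (k_nested m); exact: akm.
Qed.

End Subsequence.

(** * Auxiliary facts on injections *)

(** By induction: composing with the transposition of [f a] and [b] repairs the value at [a], and
    the values at other points avoid both [f a] and [b]. *)
Lemma partial_injection_perm (T : finType) (s : seq (T * T)) :
  (forall p q, p \in s -> q \in s -> (p.1 == q.1) = (p.2 == q.2)) ->
  exists f : {perm T}, forall p, p \in s -> f p.1 = p.2.
Proof.
elim: s => [|[a b] s IHs] inj; first by exists 1.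
have [p q ps qs|f fs] := IHs; first by apply: inj; rewrite inE ?ps ?qs orbT.
exists (f * tperm (f a) b) => p; rewrite inE permM => /predU1P[->|ps] /=.
  by rewrite tpermL.
have := inj p (a, b); rewrite !inE ps eqxx orbT /= -(fs p ps) => /(_ isT isT) pab.
have [/eqP pa|pa] := boolP (p.1 == a).
  by move: pab; rewrite pa eqxx => /esym/eqP <-; rewrite tpermL.
rewrite tpermD //; last by rewrite eq_sym -pab.
by rewrite (inj_eq perm_inj) eq_sym.
Qed.

Lemma injective_eventually_notin (X : eqType) (f : nat -> X) (s : seq X) :
  injective f -> exists N, forall n, (N <= n)%N -> f n \notin s.
Proof.
move=> f_inj; elim: s => [|x s [N Ns]]; first by exists 0%N.
have [[m <-]|xf] := pselect (exists m, f m = x).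
  exists (maxn m.+1 N) => n; rewrite geq_max => /andP[mn /Ns ns].
  by rewrite inE negb_or ns andbT (inj_eq f_inj) gtn_eqF.
exists N => n /Ns ns; rewrite inE negb_or ns andbT.
by apply/eqP => fx; apply: xf; exists n.
Qed.

(** * The selective topology built from separating finite quotients *)

Section Construction.
Variables (X : choiceType) (G : groupType) (gen : X -> G).
Hypotheses (cardX : has_cardinality_continuum X)
  (embG : continuum_embeddable G).
(** For [g != 1], [h g] sends the generators into a finite group so that [g] survives, whatever
    happens to generators outside the finite list [L g]. *)
Variables (K : G -> finGroupType) (h : forall g, X -> K g) (L : G -> seq X).
Hypothesis extend : forall g (f : X -> K g),
  exists2 phi : G -> K g, {morph phi : u v / u * v} &
    forall x, phi (gen x) = f x.
Hypothesis separate : forall g (phi : G -> K g), g != 1 ->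
  {morph phi : u v / u * v} -> (forall x, x \in L g -> phi (gen x) = h g x) ->
  phi g != 1.

(* The coordinate (g, y) is the y-th copy of the one that separates g from 1. *)
Let I : choiceType := (G * X)%type.

(* The first component enumerates the support; the second gives, for the n-th
   term and the j-th coordinate of the support, the code of an element. *)
Let S : Type := ((nat -> I) * (nat -> nat -> nat))%type.

Let exists_embedding : exists e : S * option nat -> X, injective e.
Proof.
have [b [b' bK b'K]] := continuum_bijection cardX.
have embX : continuum_embeddable X by exists b; apply: can_inj bK.
have embN := embeddable_count nat.
have [f f_inj] : continuum_embeddable (S * option nat).
  apply: embeddable_prod (embeddable_option embN); apply: embeddable_prod.
    exact/embeddable_nat_fun/embeddable_prod.
  exact/embeddable_nat_fun/embeddable_nat_fun.
by exists (b' \o f); apply: inj_comp f_inj; exact: can_inj b'K.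
Qed.

(** [e (s, Some n)] is the generator x_{s,n}, and [e (s, None)] is x_{s,oo}. *)
Let e := sval (cid exists_embedding).
Let e_inj : injective e := svalP (cid exists_embedding).

Let exists_inverse : exists e' : X -> option (S * option nat), pcancel e e'.
Proof.
have /choice[e' e'P] x : exists o, forall p, e p = x -> o = Some p.
  have [[p <-]|ex] := pselect (exists p, e p = x).
    by exists (Some p) => q /e_inj ->.
  by exists None => p epx; case: ex; exists p.
by exists e' => p; apply: e'P.
Qed.

Let e' := sval (cid exists_inverse).
Let eK : pcancel e e' := svalP (cid exists_inverse).

Let find_index (u : nat -> I) (i : I) : option nat :=
  if pselect (exists j, u j = i) is left uj then Some (sval (cid uj)) else None.

Let find_indexP u i j : find_index u i = Some j -> u j = i.
Proof. by rewrite /find_index; case: pselect => // uj [<-]; case: cid. Qed.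

Let find_index_some u j : find_index u (u j) <> None.
Proof. by rewrite /find_index; case: pselect => // -[]; exists j. Qed.

(** The limit of a sequence of codes, with value [0] if there is none. *)
Let eventual (v : nat -> nat) : nat :=
  xget 0%N [set c | exists N, forall n, (N <= n)%N -> v n = c].

Let eventualE v c N : (forall n, (N <= n)%N -> v n = c) -> eventual v = c.
Proof.
move=> vc; apply: xget_unique; first by exists N.
by move=> d [M vd]; rewrite -(vc (maxn M N)) ?vd ?leq_maxl ?leq_maxr.
Qed.

Let decode (i : I) (n : nat) : K i.1 := nth 1 (enum (K i.1)) n.

(* Off the support of s, all x_{s,n} but finitely many are given the coordinate
   of x_{s,oo}, so convergence is preserved. *)
Let theta (i : I) (x : X) : K i.1 :=
  if e' x is Some (s, o) then
    if find_index s.1 i is Some j then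
      decode i (if o is Some n then s.2 n j else eventual (s.2^~ j))
    else if x \in L i.1 then h i.1 x else h i.1 (e (s, None))
  else h i.1 x.

Let phi (i : I) : G -> K i.1 := s2val (cid2 (extend (theta i))).

Let phiM i : {morph phi i : u v / u * v} := s2valP (cid2 (extend (theta i))).

Let phi_gen i x : phi i (gen x) = theta i x :=
  s2valP' (cid2 (extend (theta i))) x.

Let phi_sep g : g != 1 -> exists i, phi i g != 1.
Proof.
move=> g1; have [b [b' _ _]] := continuum_bijection cardX.
pose x0 := b' (fun=> true).
(* [a] runs through the second components of all coordinates in the supports attached to generators
   in [L g]. For a [y] that it misses, [(g, y)] lies outside these supports. *)
pose a n := if unpickle n is Some p then
    if e' (nth x0 (L g) p.1) is Some q then (q.1.1 p.2).2 else x0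
  else x0.
have [y ay] := continuum_not_enumerable a cardX.
exists (g, y); apply: separate => // x xL; rewrite phi_gen /theta.
case Ex: (e' x) => [[s o]|] //=; rewrite xL.
case Ej: (find_index s.1 _) => [j|] //.
case: (ay (pickle (index x (L g), j))).
by rewrite /a pickleK /= nth_index // Ex /= (find_indexP Ej).
Qed.

Let selective : selectively_sequentially_pseudocompact
  (topologize (initial_topology phi)).
Proof.
move=> U Uop.
have /choice[g gU] n : exists g, U n g by case: (Uop n) => _ [g]; exists g.
have /choice[F FU] n : exists F, cylinder phi F (g n) `<=` U n.
  by have [/initial_openE/(_ _ (gU n))] := Uop n.
have [b [b' _ _]] := continuum_bijection cardX.
pose i0 : I := (1, b' (fun=> true)).
(* [u] enumerates all coordinates in the lists [F n]; it becomes the support of [s]. *)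
pose u m : I := if unpickle m is Some p then nth i0 (F p.1) p.2 else i0.
have Fu n i : i \in F n -> exists j, u j = i.
  move=> iF; exists (pickle (n, index i (F n))).
  by rewrite /u pickleK /= nth_index.
pose a j n : nat := enum_rank (phi (u j) (g n)).
have [k k_incr ak] : exists2 k, increasing_seq k &
    forall j, exists c N, forall m, (N <= m)%N -> a j (k m) = c.
  apply: (@diagonal_subsequence _ (fun j => #|K (u j).1|)) => j n.
  exact: ltn_ord.
have k_inj : injective k by apply: incn_inj.
pose s : S := (u, fun m j => a j (k m)).
have decode_a i j n : find_index u i = Some j -> decode i (a j n) = phi i (g n).
  by move=> /find_indexP <-; rewrite /decode /a nth_enum_rank.
have xU m : U (k m) (gen (e (s, Some m))).
  apply: FU => i /Fu[j uj]; rewrite phi_gen /theta eK /=.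
  case Ej: find_index => [j'|]; first exact: decode_a.
  by rewrite -uj in Ej; have := find_index_some Ej.
(* Off the range of [k], any point of [U n] serves. *)
have /choice[x xP] n :
    exists x, U n x /\ forall m, k m = n -> x = gen (e (s, Some m)).
  have [[m <-]|nk] := pselect (exists m, k m = n).
    by exists (gen (e (s, Some m))); split=> // m' /k_inj ->.
  by exists (g n); split=> // m km; case: nk; exists m.
exists x; split=> [n|]; first by have [] := xP n.
exists k; split=> //; exists (gen (e (s, None))).
apply: cvg_initial => i.
have xk m : (x \o k) m = gen (e (s, Some m)) by have [_] := xP (k m); apply.
(* In the support, the codes along [k] are eventually constant, with [eventual] as their value. *)
case Ej: (find_index u i) => [j|].
  have [c [N akc]] := ak j; exists N => n Nn.
  by rewrite xk !phi_gen /theta !eK /= Ej (eventualE akc) akc.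
(* Outside the support, only finitely many x_{s,n} lie in [L i.1]. The others take the value of [h]
   at x_{s,oo}, which is the coordinate of x_{s,oo} in either branch. *)
have [|N NL] := @injective_eventually_notin _ (fun n => e (s, Some n)) (L i.1).
  by move=> m n /e_inj[].
exists N => n /NL nL; rewrite xk !phi_gen /theta !eK /= Ej (negPf nL).
by case: ifP.
Qed.

Lemma selective_topology : admits_group_topology
  (fun T => selectively_sequentially_pseudocompact T /\ zero_dimensional_space T) G.
Proof.
exists (initial_topology phi); first exact: initial_group_topology.
by split; [exact: selective | exact: initial_zero_dimensional].
Qed.

End Construction.

(** * Residual finiteness of free groups *)

Section FreeGroupResiduallyFinite.
Variable X : choiceType.
Implicit Types (x : X) (w : seq (X * bool)) (g : free_group X).

Lemma reduced_word_onth w j x b : reduced_word w ->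
  onth w j = Some (x, b) -> onth w j.+1 <> Some (x, ~~ b).
Proof.
elim: w j => [|a w IHw] [|j] //= rw.
  move=> [aE]; case: w rw {IHw} => [|c w] //= /andP[+ _] [cE].
  by rewrite aE cE eqxx.
exact: IHw (reduced_behead rw).
Qed.

(* In a permutation representation satisfying these constraints, [w], read from
   left to right, moves [0] through [1], [2], ... up to [size w]. *)
Definition word_edge w x (p : 'I_(size w).+1 * 'I_(size w).+1) : bool :=
  (onth w p.1 == Some (x, true)) && (p.2 == p.1.+1 :> nat) ||
  (onth w p.2 == Some (x, false)) && (p.1 == p.2.+1 :> nat).

Arguments word_edge : clear implicits.

(** Two distinct edges for [x] with a common source or a common target would come from adjacent
    mutually inverse letters. *)
Lemma word_edge_injective w x p q : reduced_word w ->
  word_edge w x p -> word_edge w x q -> (p.1 == q.1) = (p.2 == q.2).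
Proof.
move=> /reduced_word_onth rw; case: p q => [p1 p2] [q1 q2].
rewrite /word_edge -!val_eqE /=.
move=> /orP[] /andP[/eqP wp /eqP ->] /orP[] /andP[/eqP wq /eqP ->];
  rewrite ?eqSS //; [have := rw _ _ _ wp|have := rw _ _ _ wq] => nw.
- transitivity false; [|apply/esym]; apply/eqP => E.
    by have := rw _ _ _ wq; rewrite -E wp.
  by apply: nw; rewrite E wq.
- transitivity false; [|apply/esym]; apply/eqP => E.
    by have := rw _ _ _ wp; rewrite E wq.
  by apply: nw; rewrite -E wp.
Qed.

Lemma word_perm_exists g x : exists f : {perm 'I_(size g).+1},
  forall p, word_edge g x p -> f p.1 = p.2.
Proof.
have [p q|f fP] :=
    @partial_injection_perm _ [seq p <- enum predT | word_edge g x p].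
  rewrite !mem_filter => /andP[+ _] /andP[+ _].
  exact: word_edge_injective (valP g).
by exists f => p px; apply: fP; rewrite mem_filter px mem_enum.
Qed.

Definition word_perm g x : {perm 'I_(size g).+1} :=
  sval (cid (word_perm_exists g x)).

Lemma word_permP g x p : word_edge g x p -> word_perm g x p.1 = p.2.
Proof. exact: svalP (cid (word_perm_exists g x)) p. Qed.

Lemma word_perm_path g n : (n <= size g)%N ->
  (\prod_(a <- take n g) letter_val (word_perm g) a) ord0 = inord n.
Proof.
elim: n => [|n IHn] ng.
  by rewrite take0 big_nil perm1; apply: val_inj; rewrite /= inordK.
have gn : (n < (size g).+1)%N by rewrite ltnS ltnW.
case gE: (onth g n) => [[x b]|]; last by have := onthTE g n; rewrite gE ng.
rewrite (take_nth (x, b)) // big_rcons /= permM IHn ?(ltnW ng) //.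
have -> : nth (x, b) g n = (x, b) by exact: onth_nth gE.
rewrite /letter_val /=; case: b gE => gE.
  apply: (@word_permP g x (inord n, inord n.+1)).
  by rewrite /word_edge /= !inordK // gE !eqxx.
apply: (@perm_inj _ (word_perm g x)); rewrite permKV.
apply/esym/(@word_permP g x (inord n.+1, inord n)).
by rewrite /word_edge /= !inordK // gE !eqxx orbT.
Qed.

(** The permutation [phi g] moves [0] to [size g], which is nonzero for [g != 1]. *)
Lemma free_group_separate g (phi : free_group X -> {perm 'I_(size g).+1}) :
  g != 1 -> {morph phi : u v / u * v} ->
  (forall x, x \in map fst (g : seq _) -> phi (free_gen x) = word_perm g x) ->
  phi g != 1.
Proof.
move=> g1 phiM phi_g; apply/eqP => phi1.
have := word_perm_path (leqnn (size g)); rewrite take_size.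
have -> : \prod_(a <- g) letter_val (word_perm g) a = phi g.
  rewrite (@free_lift_unique _ _ (phi \o @free_gen X)) //.
  rewrite /free_lift !big_seq; apply: eq_bigr => a ag.
  by rewrite /letter_val /= phi_g //; apply: map_f.
rewrite phi1 perm1 => /(congr1 val); rewrite /= inordK // => /esym/eqP.
by rewrite size_eq0; apply/negP; apply: contraNneq g1 => g0; apply/eqP/val_inj.
Qed.

Lemma embeddable_free_group :
  continuum_embeddable X -> continuum_embeddable (free_group X).
Proof.
move=> embX; apply: (embeddable_inj val_inj).
exact/embeddable_seq/embeddable_prod/embeddable_count.
Qed.

End FreeGroupResiduallyFinite.

(** * Residual finiteness of free abelian groups *)

Section FreeAbelianResiduallyFinite.
Import GRing.Theory.
Local Open Scope ring_scope.
Variable X : choiceType.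
Implicit Types (x y : X) (g : {freeg X}).

Definition freeg_gen x : {freeg X} := << 1 *g x >>.

(** With c the coefficient of the first generator in the support, ['I_(modulus g).+1] is Z/(|c|+1),
    where c stays nonzero. *)
Definition modulus g : nat := if dom g is x :: _ then `|coeff x g|%N else 0%N.

Definition residue g x : 'I_(modulus g).+1 :=
  if dom g is y :: _ then if x == y then inZp 1 else 0 else 0.

(** The values of [f] are lifted to integers, extended linearly by [fglift], and reduced modulo
    [m.+1]. *)
Lemma freeg_extend m (f : X -> 'I_m.+1) :
  exists2 phi : GRing.to_multiplicative {freeg X} -> 'I_m.+1,
    {morph phi : u v / (u * v)%g} & forall x, phi (freeg_gen x) = f x.
Proof.
pose f' x : int^o := (f x : nat)%:Z.
exists (fun D => (inZp 1 : 'I_m.+1) *~ fglift f' D) => [u v|x].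
  have fA : additive (fglift f') := lift_is_additive f'.
  pose F : {additive {freeg X} -> int^o} :=
    HB.pack (fglift f') (GRing.isAdditive.Build _ _ _ fA).
  by rewrite [fglift _ _](raddfD F) mulrzDr.
rewrite liftU scale1r /f' -pmulrn Zp_mulrn; apply: val_inj.
by rewrite /= modnMml mul1n modn_small.
Qed.

Lemma freeg_morphE m (phi : GRing.to_multiplicative {freeg X} -> 'I_m.+1) g :
  {morph phi : u v / (u * v)%g} ->
  phi g = \sum_(x <- dom g) phi (freeg_gen x) *~ coeff x g.
Proof.
move=> phiM.
have phiA : additive (phi : {freeg X} -> 'I_m.+1).
  have phiN v : phi (- v) = - phi v := group_morphV phiM v.
  by move=> u v; rewrite -phiN; apply: phiM.
pose F : {additive {freeg X} -> 'I_m.+1} :=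
  HB.pack (phi : {freeg X} -> 'I_m.+1) (GRing.isAdditive.Build _ _ _ phiA).
rewrite -{1}(freeg_sumE g) [LHS](raddf_sum F).
by apply: eq_bigr => x _; rewrite -(raddfMz F) freeg_mulz intz.
Qed.

(** [residue g] vanishes on all generators but the first of the support, so [phi g] is the class of
    the coefficient of that one. *)
Lemma freeg_separate g
    (phi : GRing.to_multiplicative {freeg X} -> 'I_(modulus g).+1) :
  g != 0 -> {morph phi : u v / (u * v)%g} ->
  (forall x, x \in dom g -> phi (freeg_gen x) = residue g x) -> phi g != 1%g.
Proof.
move=> g0 phiM phi_g.
have -> : phi g = \sum_(x <- dom g) residue g x *~ coeff x g.
  by rewrite freeg_morphE // !big_seq; apply: eq_bigr => x /phi_g->.
move: g0 (uniq_dom g) (mem_dom g).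
rewrite -dom_eq0 /residue /modulus {phi phiM phi_g}.
case: (dom g) => // x s _ /= /andP[xs _] /(_ x).
rewrite mem_head => /esym cx.
rewrite big_cons eqxx big_seq big1 => [|y ys]; last first.
  by rewrite (negPf (memPn xs _ ys)) mul0rz.
rewrite addr0 -[1%g]/(0 : 'I__.+1).
(* The sign of the coefficient does not affect vanishing. *)
have -> : (inZp 1 *~ coeff x g == 0 :> 'I_(`|coeff x g|).+1) =
    (inZp 1 *+ `|coeff x g|%N == 0 :> 'I_(`|coeff x g|).+1).
  by case: (intP (coeff x g)) => // n; rewrite mulrNz oppr_eq0 -pmulrn abszN.
by rewrite Zp_mulrn -val_eqE /= modnMml mul1n modn_small // absz_eq0.
Qed.

Lemma embeddable_freeg :
  continuum_embeddable X -> continuum_embeddable {freeg X}.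
Proof.
move=> embX; apply: (@embeddable_inj _ _ (fun D => fgenum D : seq _)).
  by apply: can_inj (Freeg_enum (K := X)).
exact/embeddable_seq/embeddable_prod/embX/embeddable_count.
Qed.

End FreeAbelianResiduallyFinite.

(* GRing.to_multiplicative only restates the additive group {freeg X} (the free
   abelian group on X) as a groupType, with the same carrier. *)
Theorem corollary7p5 (X : choiceType) (cardX : has_cardinality_continuum X) :
  admits_group_topology
    (fun T => selectively_sequentially_pseudocompact T /\ zero_dimensional_space T)
    (free_group X) /\
  admits_group_topology
    (fun T => selectively_sequentially_pseudocompact T /\ zero_dimensional_space T)
    (GRing.to_multiplicative {freeg X}).
Proof.
have embX : continuum_embeddable X.
  by have [b /bij_inj b_inj] := continuum_bijection cardX; exists b.
split.
- apply: (selective_topology cardX (embeddable_free_group embX)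
    (K := fun g => {perm 'I_(size g).+1}) _ (@free_group_separate X)) => g f.
  exists (free_lift f); [exact: free_liftM | exact: free_lift_gen].
- apply: (@selective_topology X (GRing.to_multiplicative {freeg X})
    (@freeg_gen X) cardX (embeddable_freeg embX)
    (fun g => 'I_(modulus g).+1) (@residue X) (fun g => dom g)
    _ (@freeg_separate X)) => g f.
  exact: freeg_extend.
Qed.
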